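(* Let $q$ be a prime power, $n\ge2$, and let $\mathcal M=(\mathcal L(E),\rho_{\mathcal M})$ be a $q$-matroid of rank one on $E=\mathbb F_q^n$. Then there is no integer $m>1$ such that $\mathcal M$ is purely $m$-multilinear.
   Context: $\mathcal L(E)$ is the set of subspaces of $E$; $U^\perp$ is the orthogonal complement under the standard dot product. A $q$-matroid on $E$ is $(\mathcal L(E),\rho)$ with $\rho:\mathcal L(E)\to\mathbb Z$ satisfying $0\le\rho(A)\le\dim A$, $A\subseteq B\Rightarrow\rho(A)\le\rho(B)$, and $\rho(A\cap B)+\rho(A+B)\le\rho(A)+\rho(B)$; its rank is $\rho(E)$. For an $\mathbb F_q$-linear $\mathcal C\subseteq\mathbb F_q^{n\times m}$ of dimension $k'$, $\rho_{\mathcal C}(U)=(k'-\dim\mathcal C(U^\perp))/m$ with $\mathcal C(W)=\{M\in\mathcal C:\operatorname{colsp}(M)\subseteq W\}$; $\mathcal M$ is $\mathbb F_q^{n\times m}$-representable if its rank function is $\rho_{\mathcal C}$ for some such $\mathcal C$. For $x\in\mathbb F_{q^m}^n$, $\operatorname{supp}(x)$ is the column space of the $n\times m$ matrix over $\mathbb F_q$ expanding the coordinates of $x$ in a fixed $\mathbb F_q$-basis of $\mathbb F_{q^m}$; $\mathcal M$ is $\mathbb F_{q^m}$-representable if its rank function is $W\mapsto K-\dim_{\mathbb F_{q^m}}\{x\in\mathcal C:\operatorname{supp}(x)\subseteq W^\perp\}$ for some $\mathbb F_{q^m}$-linear $\mathcal C\subseteq\mathbb F_{q^m}^n$ of dimension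 $K$. For $m>1$, $\mathcal M$ is purely $m$-multilinear if it is $\mathbb F_q^{n\times m}$-representable but not $\mathbb F_{q^m}$-representable. *)

(* Defs.v *)
From HB Require Import structures.
From mathcomp Require Import all_boot all_order all_algebra all_field.

Set Implicit Arguments.
Unset Strict Implicit.
Unset Printing Implicit Defensive.

Import GRing.Theory Num.Theory.
Local Open Scope ring_scope.

Section Subspaces.
Variables (F : finFieldType) (n : nat).

Definition dotp (x y : 'cV[F]_n) : F := \sum_i x i 0 * y i 0.

(* A subspace given by a membership condition is encoded as the span of the
   (finite) list of the vectors satisfying it.  For each such encoding a [mem_]
   lemma shows that taking the span adds no vector. *)
Definition orthov (U : {vspace 'cV[F]_n}) : {vspace 'cV[F]_n} :=
  <<enum [pred y : 'cV[F]_n | [forall x in U, dotp x y == 0%R]]>>%VS.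

Definition colsp m (A : 'M[F]_(n, m)) : {vspace 'cV[F]_n} :=
  <<[seq col j A | j <- enum 'I_m]>>%VS.

Lemma colsp_subP m (A : 'M[F]_(n, m)) (W : {vspace 'cV[F]_n}) :
  reflect (forall j, col j A \in W) (colsp A <= W)%VS.
Proof.
apply: (iffP span_subvP) => [sAW j | sAW _ /mapP[j _ ->] //].
by apply: sAW; apply/map_f; rewrite mem_enum.
Qed.

End Subspaces.

Lemma mem_span_closed (K : fieldType) (vT : vectType K) (s : seq vT) v :
    0 \in s -> (forall a x y, x \in s -> y \in s -> a *: x + y \in s) ->
  (v \in <<s>>%VS) = (v \in s).
Proof.
move=> s0 sD; apply/idP/idP => [|/memv_span //].
move=> /(@coord_span _ _ _ (in_tuple s)) ->.
apply: (big_ind (fun x => x \in s)) => // [x y xs ys | i _].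
  by rewrite -[x]scale1r sD.
by rewrite -[X in X \in _]addr0 sD // mem_nth.
Qed.

Lemma mem_orthov (F : finFieldType) (n : nat) (U : {vspace 'cV[F]_n}) y :
  (y \in orthov U) = [forall x in U, dotp x y == 0].
Proof.
rewrite mem_span_closed; first by rewrite mem_enum inE.
  rewrite mem_enum inE.
  by apply/forall_inP=> x _; rewrite /dotp big1 // => i _; rewrite mxE mulr0.
move=> a u v; rewrite !mem_enum !inE.
move=> /forall_inP Hu /forall_inP Hv; apply/forall_inP=> x xU.
have -> : dotp x (a *: u + v) = a * dotp x u + dotp x v.
  rewrite /dotp mulr_sumr -big_split; apply: eq_bigr => i _.
  by rewrite !mxE mulrDr mulrCA.
by rewrite (eqP (Hu x xU)) (eqP (Hv x xU)) mulr0 addr0.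
Qed.

Record qmatroid (F : finFieldType) (n : nat) := QMatroid {
  qrho :> {vspace 'cV[F]_n} -> int;
  qrho_bound : forall A, 0 <= qrho A <= (\dim A)%:Z;
  qrho_mono : forall A B, (A <= B)%VS -> qrho A <= qrho B;
  qrho_submod : forall A B,
    qrho (A :&: B)%VS + qrho (A + B)%VS <= qrho A + qrho B
}.

Definition qrank (F : finFieldType) (n : nat) (M : qmatroid F n) : int :=
  M fullv.

Section MatrixCodes.
Variables (F : finFieldType) (n m : nat).

Definition code_within (C : {vspace 'M[F]_(n, m)}) (W : {vspace 'cV[F]_n}) :
    {vspace 'M[F]_(n, m)} :=
  <<enum [pred A : 'M[F]_(n, m) | (A \in C) && (colsp A <= W)%VS]>>%VS.

Lemma mem_code_within C W A :
  (A \in code_within C W) = (A \in C) && (colsp A <= W)%VS.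
Proof.
rewrite mem_span_closed; first by rewrite mem_enum inE.
  rewrite mem_enum inE mem0v; apply/colsp_subP => j.
  by rewrite (_ : col j 0 = 0) ?mem0v //; apply/colP=> i; rewrite !mxE.
move=> a x y; rewrite !mem_enum !inE.
move=> /andP[xC /colsp_subP xW] /andP[yC /colsp_subP yW].
rewrite rpredD ?rpredZ //; apply/colsp_subP => j.
by rewrite linearD linearZ /= rpredD ?rpredZ ?xW ?yW.
Qed.

(* Rational-valued, since the quotient by m need not be an integer. *)
Definition rho_code (C : {vspace 'M[F]_(n, m)}) (U : {vspace 'cV[F]_n}) : rat :=
  ((\dim C)%:R - (\dim (code_within C (orthov U)))%:R) / m%:R.

End MatrixCodes.

Definition matrix_representable (F : finFieldType) (n m : nat)
    (M : qmatroid F n) : Prop :=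
  exists C : {vspace 'M[F]_(n, m)},
    forall U : {vspace 'cV[F]_n}, (M U)%:~R = rho_code C U.

Section VectorCodes.
Variables (F : finFieldType) (L : fieldExtType F) (n : nat).

(* The fixed F-basis of L is [vbasis fullv]; the column space below does not
   depend on this choice. *)
Definition expand_mx (x : 'cV[L]_n) : 'M[F]_(n, \dim {:L}) :=
  \matrix_(i, j) coord (vbasis {:L}) j (x i 0).

Definition supp (x : 'cV[L]_n) : {vspace 'cV[F]_n} := colsp (expand_mx x).

(* [finvect_type L] is L itself, equipped with the finite type structure that
   is needed to enumerate L^n. *)
Definition vcode_within (C : {vspace 'cV[L]_n}) (W : {vspace 'cV[F]_n}) :
    {vspace 'cV[L]_n} :=
  <<enum [pred x : 'cV[finvect_type L]_n |
             (x \in C) && (supp x <= W)%VS]>>%VS.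

Lemma supp_linear_sub (W : {vspace 'cV[F]_n}) (a : L) (x y : 'cV[L]_n) :
  (supp x <= W)%VS -> (supp y <= W)%VS -> (supp (a *: x + y) <= W)%VS.
Proof.
move=> /colsp_subP xW /colsp_subP yW; apply/colsp_subP => j.
pose b := vbasis {:L}.
have -> : col j (expand_mx (a *: x + y)) =
    \sum_(k < \dim {:L}) coord b j (a * b`_k) *: col k (expand_mx x)
    + col j (expand_mx y).
  apply/colP=> i; rewrite !mxE summxE linearD /=; congr (_ + _).
  rewrite [in LHS](coord_vbasis (memvf (x i 0))) mulr_sumr linear_sum /=.
  by apply: eq_bigr => k _; rewrite !mxE -scalerAr linearZ /= mulrC.
by rewrite rpredD // rpred_sum // => k _; rewrite rpredZ.
Qed.

Lemma mem_vcode_within C W x :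
  (x \in vcode_within C W) = (x \in C) && (supp x <= W)%VS.
Proof.
pose s : seq 'cV[L]_n :=
  enum [pred x : 'cV[finvect_type L]_n | (x \in C) && (supp x <= W)%VS].
have memE z : (z \in s) = (z \in C) && (supp z <= W)%VS.
  exact: (@mem_enum 'cV[finvect_type L]_n
            [pred x : 'cV[finvect_type L]_n | (x \in C) && (supp x <= W)%VS]).
rewrite -[vcode_within C W]/(<<s>>%VS) mem_span_closed; first exact: memE.
  rewrite memE mem0v; apply/colsp_subP => j.
  rewrite (_ : col j _ = 0) ?mem0v //.
  by apply/colP=> i; rewrite !mxE linear0.
move=> a u v; rewrite !memE => /andP[uC uW] /andP[vC vW].
by rewrite rpredD ?rpredZ //= supp_linear_sub.
Qed.

End VectorCodes.

(* F_(q^m), which is unique up to F-isomorphism, is any extension of F of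
   degree m. *)
Definition vector_representable (F : finFieldType) (n m : nat)
    (M : qmatroid F n) : Prop :=
  exists2 L : fieldExtType F, \dim {:L} = m &
    exists C : {vspace 'cV[L]_n}, forall W : {vspace 'cV[F]_n},
      M W = (\dim C)%:Z - (\dim (vcode_within C (orthov W)))%:Z.

Definition purely_multilinear (F : finFieldType) (n m : nat)
    (M : qmatroid F n) : Prop :=
  matrix_representable m M /\ ~ vector_representable m M.

(* Main.v *)
(** A rank-one matrix code representing [M] has dimension [m], and each of its
    restrictions [C(W^\perp)] is either [C] or [0].  Hence any nonzero [A] in
    the code decides the rank function: [M W = 0] iff [colsp A <= W^\perp].
    Reading the rows of [A] as coordinates in an [F]-basis of the extension of
    degree [m] turns [A] into a vector [x] with [supp x = colsp A], and the
    line spanned by [x] represents [M]. *)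
Require Import Defs.
From mathcomp Require Import all_boot all_order all_algebra all_field.
From mathcomp Require Import all_fingroup all_solvable.

Local Open Scope ring_scope.

(* Restores [orthov], which mathcomp's sesquilinear forms shadow. *)
Import Defs.
Import GRing.Theory Num.Theory FinRing.Theory.

(** Lagrange in the additive group of [F]: the group order annihilates [1]. *)
Lemma natr_card_finField (F : finFieldType) : #|F|%:R = 0 :> F.
Proof.
by rewrite -zmodXgE -cardsT; rewrite (expg_cardG (G := [set: F]%G)) ?inE.
Qed.

(* The extension is the splitting field of [X^Q - X] with [Q = #|F|^m]: its
   [Q] roots are the fixed points of the [m]-th power of the Frobenius
   automorphism, so they already form a field. *)
Lemma fieldExt_of_degree (F : finFieldType) (m : nat) :
  (0 < m)%N -> exists L : fieldExtType F, \dim {:L} = m.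
Proof.
move=> m_gt0; pose Q := (#|F| ^ m)%N.
have Q_gt1 : (1 < Q)%N by rewrite -(exp1n m) ltn_exp2r ?finNzRing_gt1.
have size_q (R : nzRingType) : size ('X^Q - 'X : {poly R}) = Q.+1.
  by rewrite size_polyDl size_polyXn // size_polyN size_polyX.
have [|/= L] := @FinSplittingFieldFor F ('X^Q - 'X).
  by rewrite -size_poly_eq0 size_q.
rewrite rmorphB /= map_polyXn map_polyX => -[zs q_zs gen_zs].
exists L.
have Q0 : Q%:R = 0 :> L.
  rewrite -(rmorph_nat (in_alg L)) /Q natrX natr_card_finField expr0n.
  by rewrite eqn0Ngt m_gt0 /= scale0r.
(* Since [Q] vanishes in [L], the derivative of [X^Q - X] is [-1], so the polynomial is
   separable. *)
have uniq_zs : uniq zs.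
  rewrite -separable_prod_XsubC -(eqp_separable q_zs) unlock.
  rewrite derivB derivXn derivX -mulr_natr -polyC_natr Q0 mulr0 sub0r.
  by rewrite -(scaleN1r 1) coprimepZr ?oppr_eq0 ?oner_eq0 // coprimep1.
have size_zs : size zs = Q.
  apply: succn_inj; rewrite -(size_prod_XsubC _ id) -(eqp_size q_zs).
  exact: size_q.
have [/= a _ Da] := finField_galois_generator (sub1v {:L}).
rewrite dimv1 expn1 in Da.
pose Em := fixedSpace (a ^+ m)%g; have zsE : zs =i Em.
  move=> z; rewrite -root_prod_XsubC -(eqp_root q_zs) (sameP fixedSpaceP eqP).
  rewrite /root !hornerE subr_eq0 /Q; congr (_ == z).
  elim: (m) => [|i IHi]; first by rewrite gal_id.
  by rewrite expgSr expnSr exprM IHi galM ?Da ?memvf.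
(* [Em] is a subfield containing the roots [zs], and these generate [L]. *)
have EmE : Em = {:L}%VS.
  apply/eqP; rewrite eqEsubv subvf -gen_zs -[Em]subfield_closed.
  by rewrite agenvS // subv_add sub1v; apply/span_subvP=> z; rewrite zsE.
(* Compare cardinalities: [L] has [#|F| ^ \dim {:L}] elements, and [zs] lists them all without
   repetition. *)
apply/eqP; rewrite -(eqn_exp2l _ _ (finNzRing_gt1 F)) -/Q -size_zs.
rewrite -(card_vspace (fullv : {vspace finvect_type L})).
rewrite -(card_uniqP (uniq_zs : uniq (zs : seq (finvect_type L)))).
apply/eqP/eq_card => z; rewrite memvf; apply/esym.
by rewrite [LHS]zsE EmE memvf.
Qed.

Lemma expand_mx_surj (F : finFieldType) (L : fieldExtType F) (n : nat)
    (A : 'M[F]_(n, \dim {:L})) : exists x : 'cV[L]_n, expand_mx x = A.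
Proof.
exists (\col_i \sum_j A i j *: (vbasis {:L})`_j).
apply/matrixP=> i j; rewrite !mxE coord_sum_free //.
exact/basis_free/vbasisP.
Qed.

Lemma colsp_eq0 (F : finFieldType) (n m : nat) (A : 'M[F]_(n, m)) :
  (colsp A == 0)%VS = (A == 0).
Proof.
rewrite -subv0; apply/colsp_subP/eqP => [A0 | -> j].
  apply/matrixP=> i j; have := A0 j; rewrite memv0 => /eqP/matrixP/(_ i 0).
  by rewrite !mxE.
by rewrite memv0; apply/eqP/colP=> i; rewrite !mxE.
Qed.

Lemma orthov_full (F : finFieldType) (n : nat) :
  orthov (fullv : {vspace 'cV[F]_n}) = 0%VS.
Proof.
apply/eqP; rewrite -subv0; apply/subvP=> y.
rewrite mem_orthov memv0 => /forall_inP y0; apply/eqP/colP=> i.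
have /eqP := y0 (delta_mx i 0) (memvf _).
rewrite /dotp (bigD1 i) //= big1 ?addr0 => [|k /negPf ki].
  by rewrite !mxE !eqxx mul1r.
by rewrite !mxE ki mul0r.
Qed.

Lemma expand_mx0 (F : finFieldType) (L : fieldExtType F) (n : nat) :
  expand_mx (0 : 'cV[L]_n) = 0.
Proof. by apply/matrixP=> i j; rewrite !mxE linear0. Qed.

Lemma supp0 (F : finFieldType) (L : fieldExtType F) (n : nat) :
  supp (0 : 'cV[L]_n) = 0%VS.
Proof. by apply/eqP; rewrite /supp expand_mx0 colsp_eq0. Qed.

Lemma supp_scale_sub (F : finFieldType) (L : fieldExtType F) (n : nat)
    (W : {vspace 'cV[F]_n}) (a : L) (x : 'cV[L]_n) :
  (supp x <= W)%VS -> (supp (a *: x) <= W)%VS.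
Proof.
by move=> xW; rewrite -[a *: x]addr0 supp_linear_sub // supp0 sub0v.
Qed.

(** Nonzero scalars of [L] are invertible, so scaling by them preserves support containment in [W]:
    the line survives whole or only [0] does. *)
Lemma dim_vcode_within_line (F : finFieldType) (L : fieldExtType F) (n : nat)
    (x : 'cV[L]_n) (W : {vspace 'cV[F]_n}) :
  x != 0 -> \dim (vcode_within <[x]> W) = (supp x <= W)%VS.
Proof.
move=> x0; case: (boolP (supp x <= W)%VS) => xW.
  have -> : vcode_within <[x]> W = <[x]>%VS.
    apply/vspaceP=> y; rewrite mem_vcode_within andb_idr // => /vlineP[a ->].
    exact: supp_scale_sub.
  by rewrite dim_vline x0.
apply/eqP; rewrite dimv_eq0 -subv0; apply/subvP=> y.
rewrite mem_vcode_within memv0 => /andP[/vlineP[a ->]] axW.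
rewrite scaler_eq0 (negPf x0) orbF; apply: contraNT xW => a0.
by rewrite -(scalerK a0 x) supp_scale_sub.
Qed.

Theorem theorem6p9 (F : finFieldType) (n : nat) (hn : (2 <= n)%N)
    (M : qmatroid F n) (hM : qrank M = 1) :
  ~ (exists m : nat, (1 < m)%N /\ purely_multilinear m M).
Proof.
case=> m [m_gt1 [[C rhoC]]]; apply.
have m_gt0 : (0 < m)%N by apply: ltnW.
have rhoCm W : M W * m%:Z = (\dim C)%:Z - (\dim (code_within C (orthov W)))%:Z.
  apply: (@intr_inj rat); rewrite rmorphM rmorphB /= rhoC /rho_code.
  by rewrite divfK // pnatr_eq0 -lt0n.
(* Evaluate at the whole space: its orthogonal is [0], and only the zero matrix has zero column
   space. *)
have dimC : \dim C = m.
  have := rhoCm fullv; rewrite orthov_full -[M fullv]/(qrank M) hM mul1r.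
  rewrite (_ : code_within C 0 = 0%VS) ?dimv0 ?subr0 => [[]//|].
  apply/eqP; rewrite -subv0; apply/subvP=> B.
  by rewrite mem_code_within subv0 colsp_eq0 memv0 => /andP[].
pose A := vpick C.
have A0 : A != 0 by rewrite vpick0 -dimv_eq0 dimC -lt0n.
have rhoA W : M W = (~~ (colsp A <= orthov W)%VS)%:Z.
  have Ain : (A \in code_within C (orthov W)) = (colsp A <= orthov W)%VS.
    by rewrite mem_code_within memv_pick.
  have := rhoCm W; rewrite dimC.
  have /andP[rho_ge0 _] := qrho_bound M W.
  have := qrho_mono M (subvf W); rewrite -[M fullv]/(qrank M) hM.
  (* Integrality and monotonicity leave [M W] equal to [0], where the restricted code is all of [C],
     or [1], where it is zero. *)
  case: (M W) rho_ge0 => [[|[|k]]|k] // _ _.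
    rewrite mul0r => /esym/eqP; rewrite subr_eq0 => /eqP[dimE].
    suff /eqP codeE : code_within C (orthov W) == C.
      by rewrite -Ain codeE memv_pick.
    rewrite eqEdim -dimE [X in (X <= _)%N]dimC leqnn andbT; apply/subvP=> B.
    by rewrite mem_code_within => /andP[].
  rewrite mul1r => /eqP; rewrite eq_sym -subr_eq0 addrAC subrr sub0r oppr_eq0.
  rewrite eqz_nat dimv_eq0 => /eqP code0.
  by rewrite -Ain code0 memv0 A0.
have [L dimL] := fieldExt_of_degree F m m_gt0.
(* Replacing [m] by [\dim {:L}] lets [A] be read as an expansion matrix over [L]. *)
exists L => //; subst m.
have [x Dx] := expand_mx_surj _ _ _ A.
have x0 : x != 0.
  by apply: contraNneq A0 => x0; rewrite -Dx x0 expand_mx0.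
exists <[x]>%VS => W; rewrite rhoA dim_vline x0 dim_vcode_within_line //.
by rewrite /supp Dx; case: (_ <= _)%VS.
Qed.
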